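(* Let $\phi:[0,\infty)\to\mathbb{R}^n$ be a smooth, uniformly bounded function (the regressor), let $0\le q\le n$, and suppose that $\phi$ displays partial persistent excitation (PPE) with lack of persistency of order $q$, with associated rank-$(n-q)$ orthogonal projection matrix $\varPhi=N_dN_d^\top$. Let $\beta,\gamma,\delta>0$ be arbitrary and let $Q$, $\hat N_u$, $\bar N_u$, $P$ be the matrix signals generated from $\phi$ by the PE-subspace algorithm with parameters $\beta,\gamma,\delta$ described in the context. Then $P$ is continuously differentiable on $[0,\infty)$, satisfies $0\le P(t)\le I$ for all $t\ge 0$, and there exist positive reals $\rho_a,\rho_b$ such that $$\left\| P(t)-N_dN_d^\top\right\|\le \rho_a\mathrm{e}^{-\rho_b t}\qquad\text{for all } t\ge 0 .$$ Moreover, the decay rate $\rho_b$ can be made arbitrarily fast by increasing $\gamma$: for every $r>0$ there is $\gamma_0>0$ such that for every $\gamma\ge\gamma_0$ the bound $\left\| P(t)-N_dN_d^\top\right\|\le \rho_a\mathrm{e}^{-\rho_b t}$ for all $t\ge 0$ holds with $\rho_b=r$ and some $\rho_a>0$ (which may depend on $\gamma$).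
   Context: Notation: $\|\cdot\|$ is the Euclidean norm of vectors and the induced 2-norm of matrices; inequalities between symmetric matrices are in the positive semidefinite order. PPE: $\phi$ displays partial persistent excitation with lack of persistency of order $q$ ($0\le q\le n$) if there exist positive reals $T,k_a,k_b$ and a real orthogonal projection matrix $\varPhi\in\mathbb{R}^{n\times n}$ (i.e. $\varPhi^2=\varPhi=\varPhi^\top$) of rank $n-q$ such that $$k_a\varPhi\le\int_t^{t+T}\phi(\tau)\phi^\top(\tau)\,\mathrm{d}\tau\le k_b\varPhi\qquad\forall t\ge 0.$$ Let $[N_d\ N_u]$ be an orthogonal matrix such that the columns of $N_d\in\mathbb{R}^{n\times(n-q)}$ form an orthonormal basis of $\mathrm{Im}\,\varPhi$ and those of $N_u\in\mathbb{R}^{n\times q}$ form an orthonormal basis of $\mathrm{Ker}\,\varPhi$; thus $N_dN_d^\top=\varPhi$. $\mathrm{Im}\,N_d$ is called the PE subspace and $\mathrm{Im}\,N_u$ the non-PE subspace. PE-subspace algorithm with parameters $\beta,\gamma,\delta>0$: with $Q(0)=P(0)=0_{n\times n}$, $$\dot Q(t)=-\beta Q(t)+\phi(t)\phi^\top(t),$$ $$\dot P(t)=-\gamma P(t)+\gamma I-\gamma^2\int_0^t\mathrm{e}^{-\gamma(t-\tau)}\bar N_u(\tau)\bar N_u^\top(\tau)\,\mathrm{d}\tau,$$ $$\bar N_u(\tau)=\hat N_u(k\delta)\quad\text{for } k\delta\le\tau<(k+1)\delta,\ k=0,1,2,\dots,$$ where $\hat N_u(k\delta)$ is a matrix whose columns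 form an orthonormal basis of $\mathrm{Ker}\,Q(k\delta)$ (so $\hat N_u(k\delta)\hat N_u^\top(k\delta)$ is the orthogonal projection onto $\mathrm{Ker}\,Q(k\delta)$, equal to $0$ if the kernel is trivial). *)

(* Defs.v *)
From mathcomp Require Import all_boot all_order all_algebra.
From mathcomp Require Import all_classical all_reals all_analysis.

Set Implicit Arguments.
Unset Strict Implicit.
Unset Printing Implicit Defensive.

Import Order.TTheory GRing.Theory Num.Theory.
Import numFieldNormedType.Exports.

Local Open Scope classical_set_scope.
Local Open Scope ring_scope.

(* The canonical norm on matrices is the sup norm of the entries; the
   Euclidean norm and the norm it induces are needed instead. *)
Definition enorm (R : realType) (n : nat) (x : 'cV[R]_n) : R :=
  Num.sqrt (\sum_(i < n) x i 0 ^+ 2).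

Definition opnorm (R : realType) (m n : nat) (A : 'M[R]_(m, n)) : R :=
  sup [set enorm (A *m x) | x in [set x : 'cV[R]_n | enorm x <= 1]].

Definition psd (R : realType) (n : nat) (A : 'M[R]_n) : Prop :=
  A^T = A /\ forall x : 'cV[R]_n, 0 <= (x^T *m A *m x) 0 0.

Definition loewner_le (R : realType) (n : nat) (A B : 'M[R]_n) : Prop :=
  psd (B - A).

(* Signals live on [0, +oo[ but are represented by total functions on R.  All
   limits are taken within [0, +oo[, so values at negative times are irrelevant
   and only the right derivative is meant at time 0. *)
Definition is_derive_ge0 (R : realType) (V : normedModType R)
    (f : R -> V) (t : R) (l : V) : Prop :=
  (fun s => (s - t)^-1 *: (f s - f t)) @ within [set s | 0 <= s] t^' --> l.

Definition C1_ge0 (R : realType) (V : normedModType R) (f : R -> V) : Prop :=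
  exists df : R -> V,
    (forall t, 0 <= t -> is_derive_ge0 f t (df t)) /\
    {within [set t : R | 0 <= t], continuous df}.

(* C^oo on [0, +oo[; [d k] is the k-th derivative of [f]. *)
Definition smooth_ge0 (R : realType) (V : normedModType R)
    (f : R -> V) : Prop :=
  exists d : nat -> R -> V,
    (forall t, 0 <= t -> d 0%N t = f t) /\
    (forall k t, 0 <= t -> is_derive_ge0 (d k) t (d k.+1 t)).

Definition bounded_ge0 (R : realType) (n : nat) (f : R -> 'cV[R]_n) : Prop :=
  exists M : R, forall t, 0 <= t -> enorm (f t) <= M.

Definition mxintegral (R : realType) (m n : nat) (a b : R)
    (F : R -> 'M[R]_(m, n)) : 'M[R]_(m, n) :=
  \matrix_(i, j) \int[@lebesgue_measure R]_(x in `[a, b]) F x i j.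

Definition orth_proj (R : realType) (n : nat) (A : 'M[R]_n) : Prop :=
  A *m A = A /\ A^T = A.

Definition ppe_with (R : realType) (n : nat) (phi : R -> 'cV[R]_n) (q : nat)
    (Phi : 'M[R]_n) : Prop :=
  [/\ orth_proj Phi, \rank Phi = (n - q)%N &
    exists T ka kb : R, [/\ 0 < T, 0 < ka, 0 < kb &
      forall t, 0 <= t ->
        let G := mxintegral t (t + T) (fun tau => phi tau *m (phi tau)^T) in
        loewner_le (ka *: Phi) G /\ loewner_le G (kb *: Phi)]].

(* The subspaces of mxalgebra are row spaces, hence the transposes: the columns
   of N span Im A iff N^T and A^T have the same row space, and the rows of
   [kermx A^T] span the transposes of the vectors x with A *m x = 0. *)
Definition onb_Im (R : realType) (n p k : nat) (A : 'M[R]_(n, p))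
    (N : 'M[R]_(n, k)) : Prop :=
  N^T *m N = 1%:M /\ (N^T == A^T)%MS.

Definition onb_Ker (R : realType) (n p k : nat) (A : 'M[R]_(p, n))
    (N : 'M[R]_(n, k)) : Prop :=
  N^T *m N = 1%:M /\ (N^T == kermx A^T)%MS.

Definition pe_splitting (R : realType) (n q : nat) (Phi : 'M[R]_n)
    (Nd : 'M[R]_(n, n - q)) (Nu : 'M[R]_(n, q)) : Prop :=
  [/\ onb_Im Phi Nd, onb_Ker Phi Nu,
      (row_mx Nd Nu)^T *m row_mx Nd Nu = 1%:M &
      row_mx Nd Nu *m (row_mx Nd Nu)^T = 1%:M].

(* The zero-order hold of the samples [Nhat k]: for 0 <= tau the number
   [truncn (tau / delta)] is the k with k delta <= tau < (k + 1) delta.  The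
   number [d k] of columns is the dimension of the kernel at sample k. *)
Definition Nbar (R : realType) (n : nat) (delta : R) (d : nat -> nat)
    (Nhat : forall k, 'M[R]_(n, d k)) (tau : R) :
    'M[R]_(n, d (Num.truncn (tau / delta))) :=
  Nhat (Num.truncn (tau / delta)).

Definition P_rhs (R : realType) (n : nat) (gamma delta : R) (d : nat -> nat)
    (Nhat : forall k, 'M[R]_(n, d k)) (P : R -> 'M[R]_n) (t : R) : 'M[R]_n :=
  - gamma *: P t + gamma%:M
  - gamma ^+ 2 *: mxintegral 0 t (fun tau =>
      expR (- gamma * (t - tau)) *:
        (Nbar delta Nhat tau *m (Nbar delta Nhat tau)^T)).

(* As Nbar jumps at the sampling instants k delta, only continuity of P is
   required there and its differential equation is imposed at the other times,
   so that differentiability of P is not presupposed at these instants. *)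
Record pe_algorithm (R : realType) (n : nat) (beta gamma delta : R)
    (phi : R -> 'cV[R]_n) (Q : R -> 'M[R]_n) (d : nat -> nat)
    (Nhat : forall k, 'M[R]_(n, d k)) (P : R -> 'M[R]_n) : Prop := {
  pe_Q0 : Q 0 = 0;
  pe_Q_ode : forall t, 0 <= t ->
    is_derive_ge0 Q t (- beta *: Q t + phi t *m (phi t)^T);
  pe_Nhat : forall k : nat, onb_Ker (Q (k%:R * delta)) (Nhat k);
  pe_P0 : P 0 = 0;
  pe_P_cont : {within [set t : R | 0 <= t], continuous P};
  pe_P_ode : forall t, 0 <= t -> (forall k : nat, t != k%:R * delta) ->
    is_derive_ge0 P t (P_rhs gamma delta Nhat P t)
}.

(* Main.v *)
(* Once k * delta >= T, the kernel of the sample Q (k * delta) is exactly Ker Phi: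
   e^(beta t) x^T Q(t) x is nondecreasing with derivative
   e^(beta t) (phi^T x)^2, so it vanishes at t >= T only if phi^T x = 0 on
   [0, T], which excitation forbids unless Phi x = 0; conversely Phi x = 0 forces
   phi^T x = 0 at all times.  From then on the projection fed to the P equation
   is the constant 1 - Phi, and P is a double first-order low-pass filter of it:
   e^(gamma t) (P - Phi) is eventually affine in t.  Hence the decay
   (B + C t) e^(-gamma t), and any rate up to gamma / 2. *)
Require Import Defs.
From mathcomp Require Import all_boot all_order all_algebra.
From mathcomp Require Import all_classical all_reals all_analysis.
From mathcomp Require Import measurable_realfun ring lra.

Set Implicit Arguments.
Unset Strict Implicit.
Unset Printing Implicit Defensive.

Import Order.TTheory GRing.Theory Num.Theory.
Import numFieldNormedType.Exports.

Local Open Scope classical_set_scope.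
Local Open Scope ring_scope.

(** * Integrals of sampled-and-held signals *)

Section integrals.
Variable R : realType.
Notation mu := (@lebesgue_measure R).

(** The sampling instants shape the proof: the equation of [P] is not assumed there, and the held
    projections jump. The integral of a jumping signal is still continuous, so e^(gamma t) P
    coincides with a primitive [G] that is differentiable at all t >= 0, and regularity, bounds and
    decay of [P] are all read off [G]. Matrices are handled through real functions, either entrywise
    or tested on fixed vectors. The mean value theorem needs only continuity at the ends of an
    interval, which disposes both of the sampling instants and of time 0, where derivatives are
    one-sided. *)

Lemma measurable_truncn_comp (m : nat -> R) :
  measurable_fun setT (fun x : R => m (Num.truncn x)).
Proof.
move=> _ Y _; rewrite setTI.
rewrite (_ : _ @^-1` Y = \bigcup_(k in m @^-1` Y) [set x : R | Num.truncn x = k]); last first.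
  by apply/seteqP; split=> [x Yx|x [k Yk /= xk]] /=; [exists (Num.truncn x)|rewrite xk].
(* Each level set is an interval; as [truncn] is 0 on negative reals, level 0 is unbounded below. *)
apply: bigcup_measurable => -[_|k _].
  rewrite (_ : [set x : R | _] = `]-oo, 1[%classic); first exact: measurable_itv.
  apply/seteqP; split=> x /=; rewrite in_itv/= ltNge.
    by move=> /truncn0Pn.
  by move=> x1; apply/truncn0Pn.
rewrite (_ : [set x : R | _] = `[k.+1%:R, k.+2%:R[%classic); first exact: measurable_itv.
apply/seteqP; split=> x /=; rewrite in_itv/=; last exact: truncn_def.
move=> xk; rewrite -xk truncn_itv// (le_trans ler01)//.
by rewrite -truncn_gt0 xk.
Qed.

(** No bound on [m] is assumed: only the finitely many samples with index at most b / delta are met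
    on [0, b]. *)
Lemma zoh_integrable (f : R -> R) (m : nat -> R) (delta b : R) :
  0 < delta -> continuous f ->
  mu.-integrable `[0, b] (EFin \o (fun t => f t * m (Num.truncn (t / delta)))).
Proof.
move=> d0 cf; apply: measurable_bounded_integrable.
- exact: measurable_itv.
- by rewrite /= lebesgue_measure_itv/=; case: ifP => // _; rewrite -EFinD ltry.
- apply: measurable_funM.
    by apply: measurable_funTS; exact: continuous_measurable_fun.
  apply: measurable_funTS.
  rewrite (_ : (fun x : R => m _) = (fun x => m (Num.truncn x)) \o ( *%R^~ delta^-1))//.
  by apply: measurableT_comp; [exact: measurable_truncn_comp|exact: mulrr_measurable].
- have [M [_ fM]] : bounded_set (f @` `[0, b]).
    apply: compact_bounded; apply: continuous_compact; last exact: segment_compact.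
    exact: continuous_subspaceT.
  pose N := (Num.truncn (b / delta)).+1.
  exists ((`|M| + 1) * \sum_(k < N) `|m k|); split; first exact: num_real.
  move=> x Mx t /=; rewrite in_itv/= => /andP[t0 tb].
  apply: le_trans (ltW Mx); rewrite normrM ler_pM//.
    apply: fM; first by rewrite (le_lt_trans (ler_norm M))// ltrDl.
    by exists t => //=; rewrite in_itv/= t0.
  have tN : (Num.truncn (t / delta) < N)%N.
    by rewrite ltnS; apply: le_truncn; rewrite ler_pM2r ?invr_gt0.
  by rewrite (bigD1 (Ordinal tN))//= lerDl sumr_ge0.
Qed.

Lemma within_continuous_itvoo (f : R -> R) a b x :
  {within `[a, b], continuous f} -> a < x < b -> {for x, continuous f}.
Proof.
move=> cf /andP[ax xb]; apply: (within_continuous_continuous _ cf).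
  exact: lt_trans xb.
by rewrite in_itv/= ax.
Qed.

(** For t < 0 the interval is empty and the integral is 0; this glues at 0 with the parameterized
    integral on the right. *)
Lemma continuous_Rintegral0 (f : R -> R) :
  (forall b, mu.-integrable `[0, b] (EFin \o f)) ->
  continuous (fun t : R => \int[mu]_(x in `[0, t]) f x).
Proof.
move=> fi t.
have H b : 0 <= b -> {within `[0, b], continuous (fun x : R => \int[mu]_(u in `[0, x]) f u)}.
  by move=> b0; apply: parameterized_integral_continuous.
have [t0|t0|->] := ltgtP t 0.
- apply: (@cvg_trans _ ((fun=> 0 : R) @ t)).
    apply: near_eq_cvg; near=> s; rewrite /= set_itv_ge ?Rintegral_set0//.
    rewrite bnd_simp -ltNge; near: s; exact: lt_nbhsl.
  rewrite set_itv_ge ?bnd_simp -?ltNge// Rintegral_set0.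
  exact: (@cvg_cst R^o _ R (nbhs t)).
- by apply: (within_continuous_itvoo (H (t + 1) _)); lra.
- apply/left_right_continuousP; split; last first.
    by have /continuous_within_itvP[] := H 1 ler01.
  rewrite set_itv1 Rintegral_set1.
  apply: (@cvg_trans _ ((fun=> 0 : R) @ 0^'-)); last exact: (@cvg_cst R^o).
  apply: near_eq_cvg; near=> s; rewrite /= set_itv_ge ?Rintegral_set0//.
  rewrite bnd_simp -ltNge; near: s; exact: nbhs_left_lt.
Unshelve. all: by end_near. Qed.

Lemma continuous_primitive (h : R -> R) : continuous h ->
  exists G : R -> R, G 0 = 0 /\ forall t : R, 0 <= t -> is_derive t 1 G (h t).
Proof.
move=> ch.
(* Starting at -1 makes 0 an interior point, so that the derivative at 0 is two-sided. *)
pose F (t : R) := \int[mu]_(u in `[-1, t]) h u.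
have dF (t : R) : 0 <= t -> is_derive t 1 F (h t).
  move=> t0.
  have tt1 : t < t + 1 by lra.
  have t1 : -1 < t by lra.
  have hi : mu.-integrable `[-1, t + 1] (EFin \o h).
    by apply: continuous_compact_integrable; [exact: segment_compact|exact: continuous_subspaceT].
  have [dF <-] := continuous_FTC1_closed tt1 hi t1 (ch t).
  by rewrite derive1E; apply: DeriveDef.
exists (fun t : R => F t - F 0); split => [|t t0]; first by rewrite subrr.
have := dF t t0 => dFt.
by apply: is_derive_eq; rewrite subr0.
Qed.

(** On each sampling interval the derivative vanishes in the interior, so the mean value theorem
    applies; continuity carries the constant across the sampling instants. *)
Lemma derive0_cst_grid (delta : R) (f : R -> R) : 0 < delta ->
  {within [set t : R | 0 <= t], continuous f} ->
  (forall t : R, 0 < t -> (forall k : nat, t != k%:R * delta) -> is_derive t 1 f 0) ->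
  forall t, 0 <= t -> f t = f 0.
Proof.
move=> d0 cf df.
have step k t : k%:R * delta <= t <= k.+1%:R * delta -> f t = f (k%:R * delta).
  move=> /andP[kt tk]; apply/eqP; rewrite -subr_eq0; apply/eqP.
  have kd : 0 <= k%:R * delta by rewrite mulr_ge0// ltW.
  have df0 (x : R) : x \in `]k%:R * delta, t[ -> is_derive x 1 f 0.
    rewrite in_itv/= => /andP[kx xt]; apply: df; first exact: le_lt_trans kx.
    move=> j; apply/eqP => xj; move: kx xt; rewrite xj.
    rewrite ltr_pM2r// ltr_nat => kj jt.
    have := lt_le_trans jt tk; rewrite ltr_pM2r// ltr_nat ltnS.
    by rewrite leqNgt kj.
  have cf0 : {within `[k%:R * delta, t], continuous f}.
    apply: continuous_subspaceW cf => x /=; rewrite in_itv/= => /andP[+ _].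
    exact: le_trans.
  by have [c _ ->] := MVT_segment kt df0 cf0; rewrite mul0r.
have fk k : f (k%:R * delta) = f 0.
  elim: k => [|k <-]; first by rewrite mul0r.
  by apply: step; rewrite lexx andbT ler_pM2r// ler_nat.
move=> t t0; rewrite -(fk (Num.truncn (t / delta))); apply: step.
have /andP[] := truncn_itv (divr_ge0 t0 (ltW d0)).
by rewrite ler_pdivlMr// ltr_pdivrMr// => -> /ltW.
Qed.

Lemma is_derive_expRM (g x : R) :
  is_derive x 1 (fun x => expR (g * x)) (g * expR (g * x)).
Proof.
have dl : is_derive x 1 ( *%R g : R -> R) g.
  by apply: (is_derive_eq (is_deriveZ _ _)); rewrite /GRing.scale/= mulr1.
by apply: (is_derive_eq (is_derive1_comp (is_derive_expR (g * x)) dl)); rewrite mulrC.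
Qed.

Lemma continuous_expRM (g : R) : continuous (fun x : R => expR (g * x)).
Proof.
move=> x; apply: (@continuous_comp _ _ _ ( *%R g) expR).
  exact: mulrl_continuous.
exact: continuous_expR.
Qed.

(** The held sample may already have jumped at [b]. The end points are null sets, and in between the
    integrand is c e^(g x), with primitive (c / g) e^(g x). The interval may span several samples,
    which is used once the samples have become constant. *)
Lemma zoh_integral_piece (m : nat -> R) (g delta c a b : R) :
  0 < delta -> g != 0 -> 0 <= a <= b ->
  (forall t, a <= t < b -> m (Num.truncn (t / delta)) = c) ->
  let J t := \int[mu]_(x in `[0, t]) (expR (g * x) * m (Num.truncn (x / delta))) in
  J b = J a + c * ((expR (g * b) - expR (g * a)) / g).
Proof.
move=> d0 g0 /andP[a0 ab] mc J.
have [<-|neqab] := eqVneq a b; first by rewrite subrr mul0r mulr0 addr0.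
have {neqab}ab : a < b by rewrite lt_neqAle neqab.
have cexp := @continuous_expRM g.
have fi := zoh_integrable m b d0 cexp.
have -> : J b = J a + (J b - J a) by rewrite addrC subrK.
congr (_ + _); rewrite /J (Rintegral_itvB fi) ?bnd_simp ?(ltW ab)//.
have sub : `]a, b[ `<=` `[0, b].
  by apply: subset_itvW => //; rewrite bnd_simp.
rewrite -Rintegral_itv_bndo_bndc; last first.
  by apply: integrableS fi.
rewrite (_ : \int[mu]_(x in _) _ = \int[mu]_(x in `]a, b[) (expR (g * x) * c)); last first.
  apply: eq_Rintegral => x; rewrite inE/= in_itv/= => /andP[ax xb].
  by rewrite mc// (ltW ax).
have cc : continuous (fun x => expR (g * x) * c).
  by move=> x; apply: cvgM; [exact: cexp|exact: cvg_cst].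
have ci A : compact A -> mu.-integrable A (EFin \o (fun x => expR (g * x) * c)).
  by move=> cA; apply: continuous_compact_integrable => //; exact: continuous_subspaceT.
have sab c1 c2 : [set` Interval (BSide c1 a) (BSide c2 b)] `<=` `[a, b].
  by apply: subset_itv; rewrite !bnd_simp; case: c1; case: c2; rewrite ?lexx.
rewrite Rintegral_itv_bndo_bndc; last first.
  by apply: integrableS (ci _ (@segment_compact _ a b)) => //; exact: sab.
rewrite Rintegral_itv_obnd_cbnd; last first.
  by apply: integrableS (ci _ (@segment_compact _ a b)) => //; exact: sab.
rewrite /Rintegral (continuous_FTC2 (F := fun x => expR (g * x) * (c / g)) ab)/=.
- by field.
- exact: continuous_subspaceT.
- split.
  + by move=> x _; apply: ex_derive.
  + apply: cvg_at_right_filter; apply: cvgM; [exact: cexp|exact: cvg_cst].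
  + apply: cvg_at_left_filter; apply: cvgM; [exact: cexp|exact: cvg_cst].
- move=> x _; rewrite derive1E.
  have dx := is_derive_expRM g x.
  rewrite derive_val.

  by rewrite scaler0 add0r /GRing.scale/=; field.
Qed.

End integrals.

(** * One-sided derivatives on the half line *)

Section ge0.
Variable R : realType.

Lemma cvg_mx_coord (T : Type) (F : set_system T) (FF : Filter F) (m n : nat)
    (f : T -> 'M[R]_(m, n)) (M : 'M[R]_(m, n)) :
  (forall i j, f x i j @[x --> F] --> M i j) -> f x @[x --> F] --> M.
Proof.
move=> fM; apply/cvg_ballP => e e0.
have H : \forall x \near F, forall i j, ball (M i j) e (f x i j).
  apply: filter_forall => i; apply: filter_forall => j.
  by move/cvg_ballP : (fM i j); exact.
by apply: filterS H => x H; split.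
Qed.

Lemma is_derive_ge0_coord (m n : nat) (f : R -> 'M[R]_(m, n)) (t : R) L i j :
  is_derive_ge0 f t L -> is_derive_ge0 (fun s => f s i j) t (L i j).
Proof.
rewrite /is_derive_ge0 => fL.
have FF : Filter (within [set s : R | 0 <= s] t^') by exact: within_filter.
have := @continuous_cvg _ _ _ _ FF _ (fun M : 'M[R]_(m, n) => M i j) _
  (@coord_continuous _ _ _ i j L) fL.
by apply: cvg_trans; apply: near_eq_cvg; near=> s; rewrite /= !mxE.
Unshelve. all: by end_near. Qed.

Lemma is_derive_ge0_mx (m n : nat) (f : R -> 'M[R]_(m, n)) (t : R) (L : 'M[R]_(m, n)) :
  (forall i j, is_derive_ge0 (fun s => f s i j) t (L i j)) -> is_derive_ge0 f t L.
Proof.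
move=> fL.
have FF : Filter (within [set s : R | 0 <= s] t^') by exact: within_filter.
apply: cvg_mx_coord => i j.
apply: cvg_trans (fL i j); by apply: near_eq_cvg; near=> s; rewrite !mxE.
Unshelve. all: by end_near. Qed.

Lemma is_derive_ge0_derive (f : R -> R) (t l : R) :
  0 < t -> is_derive_ge0 f t l -> is_derive t 1 f l.
Proof.
move=> t0 ftl.
have H : h^-1 *: ((f \o shift t) (h *: (1 : R)) - f t) @[h --> 0^'] --> l.
  apply/cvgrPdist_lt => e e0.
  move/cvgrPdist_lt : ftl => /(_ e e0).
  rewrite !near_withinE => /nbhs_ballP[d /= d0 dl].
  (* A radius of at most [t] keeps h + t in the half line. *)
  have td : 0 < Num.min d t by rewrite lt_min d0.
  apply/nbhs_ballP; exists (Num.min d t) => //= h.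
  rewrite /ball/= sub0r normrN lt_min => /andP[hd ht] h0.
  have := dl (h + t).
  rewrite /ball/= opprD addrCA subrr addr0 normrN /GRing.scale/= mulr1 addrK.
  apply => //.
    by rewrite -subr_eq0 addrK.
  by move: ht; rewrite ltr_norml => /andP[]; lra.
apply: DeriveDef; first by apply/cvg_ex; exists l.
exact: cvg_lim.
Qed.

Lemma derive_is_derive_ge0 (f : R -> R) (t l : R) :
  is_derive t 1 f l -> is_derive_ge0 f t l.
Proof.
move=> [fd fl].
have : h^-1 *: ((f \o shift t) (h *: (1 : R)) - f t) @[h --> 0^'] --> l.
  by rewrite -fl; exact: fd.
move=> /cvgrPdist_lt H; apply/cvgrPdist_lt => e e0.
have := H e e0; rewrite !near_withinE => /nbhs_ballP[d /= d0 dl].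
apply/nbhs_ballP; exists d => //= s; rewrite /ball/= => sd st s0.
have := dl (s - t).
rewrite /ball/= sub0r opprB /GRing.scale/= mulr1 subrK; apply => //.
by rewrite subr_eq0.
Qed.

(** Near [t] the difference quotient is within 1 of df t, hence |f s - f t| <= (|df t| + 1) |s - t|,
    also at the one-sided point 0. *)
Lemma is_derive_ge0_continuous (f df : R -> R) :
  (forall t : R, 0 <= t -> is_derive_ge0 f t (df t)) ->
  {within [set t : R | 0 <= t], continuous f}.
Proof.
move=> fd; apply/subspace_continuousP => t t0.
have /cvgrPdist_lt /(_ 1 ltr01) := fd t t0.
rewrite near_withinE near_withinE => -/nbhs_ballP[d /= d0 dl].
apply/cvgrPdist_lt => e e0; rewrite near_withinE.
pose C := `|df t| + 1.
have C0 : 0 < C by rewrite ltr_wpDl.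
apply/nbhs_ballP; exists (Num.min d (e / C)) => /=.
  by rewrite lt_min d0 divr_gt0.
move=> s; rewrite /ball/= lt_min => /andP[sd se] s0.
have [->|st] := eqVneq s t; first by rewrite subrr normr0.
have := dl s sd st s0; rewrite /GRing.scale/= => q1.
rewrite distrC in se.
have st0 : s - t != 0 by rewrite subr_eq0.
rewrite distrC (_ : f s - f t = (s - t) * ((s - t)^-1 * (f s - f t))); last by rewrite mulVKf.
rewrite normrM.
have qC : `|(s - t)^-1 * (f s - f t)| <= C.
  rewrite -[X in `|X|](subrK (df t)) (le_trans (ler_normD _ _))// addrC /C lerD2l.
  by rewrite distrC ltW.
rewrite (le_lt_trans (ler_wpM2l _ qC))//.
by rewrite -ltr_pdivlMr.
Qed.

Lemma within_coord (m n : nat) (A : set R) (f : R -> 'M[R]_(m, n)) i j :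
  {within A, continuous f} -> {within A, continuous (fun t => f t i j)}.
Proof.
move=> cf x; apply: (@continuous_comp _ _ _ (f : subspace A -> _) (fun M : 'M[R]_(m, n) => M i j)).
  exact: cf.
exact: coord_continuous.
Qed.

Lemma ge0_nondecreasing (f df : R -> R) :
  {within [set t : R | 0 <= t], continuous f} ->
  (forall t : R, 0 < t -> is_derive t 1 f (df t)) ->
  (forall t : R, 0 < t -> 0 <= df t) ->
  forall s t : R, 0 <= s <= t -> f s <= f t.
Proof.
move=> cf fd df0 s t /andP[s0 st]; rewrite -subr_ge0.
have [<-|sneqt] := eqVneq s t; first by rewrite subrr.
have {sneqt}st : s < t by rewrite lt_neqAle sneqt.
have fd' (x : R) : x \in `]s, t[ -> is_derive x 1 f (df x).
  by rewrite in_itv/= => /andP[sx _]; apply: fd; exact: le_lt_trans sx.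
have cf' : {within `[s, t], continuous f}.
  apply: continuous_subspaceW cf => x /=; rewrite in_itv/= => /andP[+ _].
  exact: le_trans.
have [c + ->] := MVT st fd' cf'; rewrite in_itv/= => /andP[sc _].
by rewrite mulr_ge0 ?subr_ge0 ?(ltW st)// df0//; exact: le_lt_trans sc.
Qed.

End ge0.

(** * Projections and quadratic forms *)

Definition quad (R : realType) (n : nat) (x : 'cV[R]_n) (A : 'M[R]_n) : R :=
  (x^T *m A *m x) 0 0.

Section linear_algebra.
Variable R : realType.

Lemma dotE (n : nat) (x : 'cV[R]_n) : (x^T *m x) 0 0 = \sum_i x i 0 ^+ 2.
Proof. by rewrite mxE; apply: eq_bigr => i _; rewrite mxE expr2. Qed.

Lemma dot_ge0 (n : nat) (x : 'cV[R]_n) : 0 <= (x^T *m x) 0 0.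
Proof. by rewrite dotE sumr_ge0// => i _; rewrite sqr_ge0. Qed.

Lemma dot_eq0 (n : nat) (x : 'cV[R]_n) : (x^T *m x) 0 0 <= 0 -> x = 0.
Proof.
move=> x0; have /eqP : (x^T *m x) 0 0 = 0 by apply: le_anti; rewrite x0 dot_ge0.
rewrite dotE psumr_eq0 => [/allP xi0|i _]; last exact: sqr_ge0.
apply/colP => i; rewrite mxE; apply/eqP.
by rewrite -sqrf_eq0; apply: xi0; rewrite mem_index_enum.
Qed.

Lemma orth_proj_quad (n : nat) (A : 'M[R]_n) (x : 'cV[R]_n) : orth_proj A ->
  (x^T *m A *m x) 0 0 = ((A *m x)^T *m (A *m x)) 0 0.
Proof. by case=> AA AT; rewrite -{1}AA trmx_mul AT !mulmxA. Qed.

Lemma orth_proj_psd (n : nat) (A : 'M[R]_n) : orth_proj A -> psd A.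
Proof. by move=> pA; split=> [|x]; [case: pA|rewrite orth_proj_quad// dot_ge0]. Qed.

Lemma orth_projC (n : nat) (A : 'M[R]_n) : orth_proj A -> orth_proj (1%:M - A).
Proof.
move=> [AA AT]; split; last by rewrite linearB/= trmx1 AT.
by rewrite mulmxBl mul1mx mulmxBr mulmx1 AA subrr subr0.
Qed.

Lemma orth_proj_onb (n k : nat) (N : 'M[R]_(n, k)) :
  N^T *m N = 1%:M -> orth_proj (N *m N^T).
Proof.
move=> NN; split; last by rewrite trmx_mul trmxK.
by rewrite mulmxA -(mulmxA N) NN mulmx1.
Qed.

(** Write A = E N^T. Then A N N^T = E N^T N N^T = A, while A N = N turns the left side into N
    N^T. *)
Lemma onb_Im_proj (n k : nat) (A : 'M[R]_n) (N : 'M[R]_(n, k)) :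
  orth_proj A -> onb_Im A N -> N *m N^T = A.
Proof.
move=> [AA AT] [NN /andP[/submxP[D ND] /submxP[E]]]; rewrite AT => AE.
have NTA : N^T *m A = N^T by rewrite ND -mulmxA AT AA.
have NA : A *m N = N by rewrite -[RHS]trmxK -[in RHS]NTA trmx_mul trmxK AT.
by rewrite -{1}NA -mulmxA {1}AE -mulmxA (mulmxA N^T) NN mul1mx -AE.
Qed.

(** Only the kernel of [Q] matters. It gives A N = 0 and 1 - A = D N^T, so that (1 - A) N N^T equals
    both N N^T and 1 - A. *)
Lemma onb_Ker_proj (n k : nat) (A Q : 'M[R]_n) (N : 'M[R]_(n, k)) :
  orth_proj A -> (forall x : 'cV[R]_n, Q *m x = 0 <-> A *m x = 0) ->
  onb_Ker Q N -> N *m N^T = 1%:M - A.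
Proof.
move=> [AA AT] kQA [NN /andP[Nker kerN]].
have colker p (B C : 'M[R]_n) (X : 'M[R]_(n, p)) :
    (forall x : 'cV[R]_n, B *m x = 0 -> C *m x = 0) -> B *m X = 0 -> C *m X = 0.
  move=> BC BX; apply/matrixP => i j.
  have /BC /colP /(_ i) : B *m col j X = 0 by rewrite colE mulmxA BX mul0mx.
  by rewrite colE mulmxA -colE !mxE.
have AN : A *m N = 0.
  apply: colker (fun x => (kQA x).1) _.
  by rewrite -[LHS]trmxK trmx_mul (sub_kermxP Nker) trmx0.
have QA : Q *m (1%:M - A) = 0.
  apply: colker (fun x => (kQA x).2) _.
  by rewrite mulmxBr mulmx1 AA subrr.
have /submxP[D AD] : ((1%:M - A)^T <= N^T)%MS.
  by apply: submx_trans kerN; apply/sub_kermxP; rewrite -trmx_mul QA trmx0.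
have AE : 1%:M - A = D *m N^T.
  by rewrite -AD linearB/= trmx1 AT.
have : (1%:M - A) *m (N *m N^T) = 1%:M - A.
  by rewrite AE -mulmxA (mulmxA N^T) NN mul1mx.
by rewrite mulmxBl mul1mx mulmxA AN mul0mx subr0.
Qed.

Lemma coord_le_enorm (n : nat) (x : 'cV[R]_n) i : `|x i 0| <= enorm x.
Proof.
rewrite -sqrtr_sqr ler_wsqrtr// (bigD1 i)//= lerDl sumr_ge0// => j _.
exact: sqr_ge0.
Qed.

Lemma enorm_le_sum (n : nat) (x : 'cV[R]_n) : enorm x <= \sum_i `|x i 0|.
Proof.
have s0 : 0 <= \sum_i `|x i 0| by rewrite sumr_ge0.
rewrite -[leRHS](ger0_norm s0) -sqrtr_sqr ler_wsqrtr//.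
rewrite [leRHS]expr2 mulr_suml ler_sum// => i _.
rewrite -real_normK ?num_real// expr2 ler_wpM2l//.
by rewrite (bigD1 i)//= lerDl sumr_ge0.
Qed.

(** A crude bound suffices: entrywise decay then yields the same rate in operator norm, only with a
    larger constant. *)
Lemma opnorm_le_sum (m n : nat) (A : 'M[R]_(m, n)) :
  opnorm A <= \sum_i \sum_j `|A i j|.
Proof.
apply: ge_sup.
  (* The supremum is bounded this way only for a nonempty set; the zero vector provides an
     element. *)
  exists (enorm (A *m 0)), 0 => //=.
  by rewrite (le_trans (enorm_le_sum _))// big1// => i _; rewrite mxE normr0.
move=> _ [x /= x1 <-]; apply: le_trans (enorm_le_sum _) _.
apply: ler_sum => i _; rewrite mxE; apply: le_trans (ler_norm_sum _ _ _) _.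
apply: ler_sum => j _; rewrite normrM ler_piMr//.
exact: le_trans (coord_le_enorm _ _) x1.
Qed.

Lemma loewner_leP (n : nat) (A B : 'M[R]_n) : loewner_le A B ->
  forall x : 'cV[R]_n, (x^T *m A *m x) 0 0 <= (x^T *m B *m x) 0 0.
Proof.
by move=> [_ AB] x; have := AB x; rewrite mulmxBr mulmxBl !mxE subr_ge0.
Qed.

Lemma bilinE (m n : nat) (u : 'cV[R]_m) (A : 'M[R]_(m, n)) (x : 'cV[R]_n) :
  (u^T *m A *m x) 0 0 = \sum_i \sum_j u i 0 * x j 0 * A i j.
Proof.
rewrite mxE exchange_big/=; apply: eq_bigr => j _; rewrite mxE mulr_suml.
by apply: eq_bigr => i _; rewrite mxE; ring.
Qed.

Lemma quadD (n : nat) (x : 'cV[R]_n) (A B : 'M[R]_n) :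
  quad x (A + B) = quad x A + quad x B.
Proof. by rewrite /quad mulmxDr mulmxDl mxE. Qed.

Lemma quadZ (n : nat) (x : 'cV[R]_n) (k : R) (A : 'M[R]_n) :
  quad x (k *: A) = k * quad x A.
Proof. by rewrite /quad -scalemxAr -scalemxAl mxE. Qed.

Lemma quadB (n : nat) (x : 'cV[R]_n) (A B : 'M[R]_n) :
  quad x (A - B) = quad x A - quad x B.
Proof. by rewrite -scaleN1r quadD quadZ mulN1r. Qed.

Lemma quad1_ge0 (n : nat) (x : 'cV[R]_n) : 0 <= quad x 1%:M.
Proof. by rewrite /quad mulmx1 dot_ge0. Qed.

End linear_algebra.

(** * The kernel of Q *)

Section kernel.
Variable R : realType.
Notation mu := (@lebesgue_measure R).

(** Both claims go through one induction because additivity of the integral needs integrability of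
    the partial sum. *)
Lemma integrable_Rintegral_sum (D : set R) (I : Type) (r : seq I)
    (f : I -> R -> R) : measurable D ->
  (forall i, mu.-integrable D (EFin \o f i)) ->
  mu.-integrable D (EFin \o (fun x => \sum_(i <- r) f i x)) /\
  \int[mu]_(x in D) (\sum_(i <- r) f i x) = \sum_(i <- r) \int[mu]_(x in D) f i x.
Proof.
move=> mD fi; elim: r => [|i r [ir IH]].
  rewrite big_nil; split.
    rewrite (_ : _ \o _ = cst 0%E); first exact: integrable0.
    by apply/funext => x /=; rewrite big_nil.
  under eq_Rintegral do rewrite big_nil.
  by rewrite Rintegral_cst// mul0r.
rewrite big_cons -IH -RintegralD//; split; last first.
  by under eq_Rintegral do rewrite big_cons.
rewrite (_ : _ \o _ = ((EFin \o f i) \+ (EFin \o (fun x => \sum_(i <- r) f i x)%R))%E).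
  exact: integrableD.
by apply/funext => x /=; rewrite big_cons EFinD.
Qed.

Lemma mxintegral_quad (n : nat) (a b : R) (F : R -> 'M[R]_n) (x : 'cV[R]_n) :
  (forall i j, mu.-integrable `[a, b] (EFin \o (fun t => F t i j))) ->
  (x^T *m mxintegral a b F *m x) 0 0 =
    \int[mu]_(t in `[a, b]) (x^T *m F t *m x) 0 0.
Proof.
move=> Fi.
have mab : measurable (`[a, b] : set R) by exact: measurable_itv.
have cFi i j : mu.-integrable `[a, b] (EFin \o (fun t => x i 0 * x j 0 * F t i j)).
  rewrite (_ : _ \o _ = (fun t => (x i 0 * x j 0)%:E * (EFin \o (fun t => F t i j)) t)%E).
    exact: integrableZl.
  by apply/funext => t /=; rewrite EFinM.
have sFi i := integrable_Rintegral_sum (index_enum 'I_n) mab (cFi i).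
under eq_Rintegral do rewrite bilinE.
rewrite (integrable_Rintegral_sum _ mab (fun i => (sFi i).1)).2 bilinE.
apply: eq_bigr => i _; rewrite (sFi i).2; apply: eq_bigr => j _.
by rewrite mxE RintegralZl.
Qed.

(** Freezing a signal at its initial value for negative times gives a function continuous on the
    whole line that agrees with it on the half line. *)
Lemma continuous_ge0_extension (f : R -> R) :
  {within [set t : R | 0 <= t], continuous f} ->
  continuous (fun t : R => f (Num.max t 0)).
Proof.
move=> cf t.
have cmax : Num.max u 0 @[u --> t] --> Num.max t 0.
  by apply: (@continuous_max _ _ id (fun=> 0 : R)); [exact: cvg_id|exact: cvg_cst].
have t0 : [set t : R | 0 <= t] (Num.max t 0) by rewrite /= le_max lexx orbT.
move/subspace_continuousP : cf => /(_ _ t0) cf A /cf fA.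
apply: (@filterS _ _ (nbhs_filter (t : R)) _ _ _ (cmax _ fA)) => u; apply.
by rewrite /= le_max lexx orbT.
Qed.

(** Monotonicity and f b <= f a squeeze [f] to a constant on ]a, b[. Applied to primitives, this
    replaces the fact that a continuous nonnegative function with zero integral vanishes. *)
Lemma nondecreasing_flat_derive0 (f : R -> R) (a b s d : R) :
  (forall u v : R, a <= u <= v -> f u <= f v) -> f b <= f a -> a < s < b ->
  is_derive s 1 f d -> d = 0.
Proof.
move=> ndf fba /andP[as_ sb] fd.
have fa u : u \in `]a, b[ -> f u = f a.
  rewrite in_itv/= => /andP[au ub]; apply: le_anti; apply/andP; split.
    by apply: le_trans fba; apply: ndf; rewrite !ltW.
  by apply: ndf; rewrite lexx ltW.
have fd' : is_derive s 1 (cst (f a) : R -> R) d.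
  apply: near_eq_is_derive fd; near=> u; apply: fa.
  by near: u; apply: near_in_itvoo; rewrite in_itv/= as_.
by rewrite -(@derive_val _ _ _ _ _ _ _ fd') derive_cst.
Unshelve. all: by end_near. Qed.


(** The excitation bounds on all windows thereby become statements about increments of a single
    nondecreasing function. *)
Lemma gram_primitive (n : nat) (phi : R -> 'cV[R]_n) (x : 'cV[R]_n) :
  (forall i, {within [set t : R | 0 <= t], continuous (fun t => phi t i 0)}) ->
  exists G : R -> R,
    (forall t : R, 0 <= t -> is_derive t 1 G (((phi t)^T *m x) 0 0 ^+ 2)) /\
    (forall a b, 0 <= a < b ->
      (x^T *m mxintegral a b (fun t => phi t *m (phi t)^T) *m x) 0 0 = G b - G a).
Proof.
move=> cphi.
pose ph i t := phi (Num.max t 0) i 0.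
have cph i : continuous (ph i) by exact: continuous_ge0_extension (cphi i).
pose p t := \sum_i ph i t * x i 0.
have cp : continuous p.
  apply: continuous_big => [|i _ t]; first exact: add_continuous.
  by apply: cvgM; [exact: cph|exact: cvg_cst].
have pE t : 0 <= t -> p t = ((phi t)^T *m x) 0 0.
  move=> t0; rewrite mxE; apply: eq_bigr => i _.
  by rewrite mxE /ph max_l.
have cp2 : continuous (fun t => p t ^+ 2).
  by move=> t; apply: cvgM; exact: cp.
have [G [_ dG]] := continuous_primitive cp2.
exists G; split => [t t0|a b /andP[a0 ab]]; first by rewrite -pE//; exact: dG.
rewrite mxintegral_quad; last first.
  move=> i j.
  have : mu.-integrable `[a, b] (EFin \o (fun t => ph i t * ph j t)).
    apply: continuous_compact_integrable; first exact: segment_compact.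
    by apply: continuous_subspaceT => t; apply: cvgM; exact: cph.
  apply: eq_integrable => //.
  move=> t; rewrite inE/= in_itv/= => /andP[ta tb].
  by rewrite mxE big_ord1 mxE /ph max_l// (le_trans a0).
rewrite (_ : \int[mu]_(t in _) _ = \int[mu]_(t in `[a, b]) (p t ^+ 2)); last first.
  apply: eq_Rintegral => t; rewrite inE/= in_itv/= => /andP[ta tb].
  rewrite pE ?(le_trans a0)// mulmxA -mulmxA.
  have -> : x^T *m phi t = ((phi t)^T *m x)^T by rewrite trmx_mul trmxK.
  by rewrite [LHS]mxE big_ord1 [X in X * _]mxE expr2.
rewrite /Rintegral (continuous_FTC2 (F := G) ab)//=.
- exact: continuous_subspaceT.
- split.
  + move=> t; rewrite in_itv/= => /andP[ta tb].
    by have := dG t (le_trans a0 (ltW ta)) => ?; apply: ex_derive.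
  + apply: cvg_at_right_filter; apply: differentiable_continuous.
    by apply/derivable1_diffP; have := dG a a0 => ?; apply: ex_derive.
  + apply: cvg_at_left_filter; apply: differentiable_continuous.
    apply/derivable1_diffP; have := dG b (le_trans a0 (ltW ab)) => ?.
    exact: ex_derive.
- move=> t; rewrite in_itv/= => /andP[ta tb]; rewrite derive1E.
  have := dG t (le_trans a0 (ltW ta)) => ?.
  exact: derive_val.
Qed.

End kernel.

Section kernelQ.
Variable R : realType.

Lemma is_derive_bilin (m n : nat) (F : R -> 'M[R]_(m, n)) (L : 'M[R]_(m, n))
    (t : R) (u : 'cV[R]_m) (x : 'cV[R]_n) :
  (forall i j, is_derive t 1 (fun s => F s i j) (L i j)) ->
  is_derive t 1 (fun s => (u^T *m F s *m x) 0 0) ((u^T *m L *m x) 0 0).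
Proof.
move=> dF.
have -> : (fun s => (u^T *m F s *m x) 0 0) =
    \sum_i \sum_j (fun s => u i 0 * x j 0 * F s i j).
  apply/funext => s; rewrite bilinE fct_sumE; apply: eq_bigr => i _.
  by rewrite fct_sumE.
rewrite bilinE; apply: is_derive_sum => i.
Qed.

Lemma within_bilin (m n : nat) (F : R -> 'M[R]_(m, n)) (A : set R)
    (u : 'cV[R]_m) (x : 'cV[R]_n) :
  (forall i j, {within A, continuous (fun s => F s i j)}) ->
  {within A, continuous (fun s => (u^T *m F s *m x) 0 0)}.
Proof.
move=> cF; under eq_fun do rewrite bilinE.
apply: continuous_big => [|i _]; first exact: add_continuous.
apply: continuous_big => [|j _]; first exact: add_continuous.
by move=> t; apply: cvgM; [exact: cvg_cst|exact: cF].
Qed.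

Variables (n : nat) (phi : R -> 'cV[R]_n) (Q : R -> 'M[R]_n) (beta : R).
Hypothesis Q0 : Q 0 = 0.
Hypothesis Q_ode : forall t, 0 <= t ->
    is_derive_ge0 Q t (- beta *: Q t + phi t *m (phi t)^T).

(** The exponential is the integrating factor that cancels - beta Q. Two vectors are kept so that
    [Q t *m x] itself can be shown to vanish, without appeal to symmetry of [Q]. *)
Let z (u x : 'cV[R]_n) t := expR (beta * t) * (u^T *m Q t *m x) 0 0.

Let z0 u x : z u x 0 = 0.
Proof. by rewrite /z Q0 mulmx0 mul0mx mxE mulr0. Qed.

Let cz u x : {within [set t : R | 0 <= t], continuous (z u x)}.
Proof.
move=> t; apply: cvgM.
  by apply: continuous_subspaceT; exact: continuous_expRM.
apply: within_bilin => i j.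
apply: (@is_derive_ge0_continuous _ _
  (fun s => (- beta *: Q s + phi s *m (phi s)^T) i j)) => s s0.
exact: is_derive_ge0_coord (Q_ode s0).
Qed.

Let dz u x (t : R) : 0 < t -> is_derive t 1 (z u x)
  (expR (beta * t) * (((phi t)^T *m u) 0 0 * ((phi t)^T *m x) 0 0)).
Proof.
move=> t0.
have dQ i j : is_derive t 1 (fun s => Q s i j)
    ((- beta *: Q t + phi t *m (phi t)^T) i j).
  apply: is_derive_ge0_derive => //.
  exact: is_derive_ge0_coord (Q_ode (ltW t0)).
have dB := is_derive_bilin u x dQ.
have dE := is_derive_expRM beta t.
apply: (is_derive_eq (is_deriveM dE dB)); rewrite /GRing.scale/=.
have -> : (u^T *m (- beta *: Q t + phi t *m (phi t)^T) *m x) 0 0 =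
    - beta * (u^T *m Q t *m x) 0 0 +
    ((phi t)^T *m u) 0 0 * ((phi t)^T *m x) 0 0.
  rewrite mulmxDr mulmxDl mxE -scalemxAr -scalemxAl [X in X + _]mxE; congr (_ + _).
  rewrite mulmxA -mulmxA.
  have -> : u^T *m phi t = ((phi t)^T *m u)^T by rewrite trmx_mul trmxK.
  by rewrite [LHS]mxE big_ord1 [X in X * _]mxE.
ring.
Qed.

Lemma ker_ppe (Phi : 'M[R]_n) (T ka kb : R) :
  (forall i, {within [set t : R | 0 <= t], continuous (fun t => phi t i 0)}) ->
  orth_proj Phi -> 0 < T -> 0 < ka ->
  (forall t, 0 <= t ->
    let G := mxintegral t (t + T) (fun tau => phi tau *m (phi tau)^T) in
    loewner_le (ka *: Phi) G /\ loewner_le G (kb *: Phi)) ->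
  forall t, T <= t -> forall x : 'cV[R]_n, Q t *m x = 0 <-> Phi *m x = 0.
Proof.
move=> cphi pPhi T0 ka0 ppe t Tt x.
have [G [dG GE]] := gram_primitive x cphi.
pose p s := ((phi s)^T *m x) 0 0.
have quadZ k : (x^T *m (k *: Phi) *m x) 0 0 = k * ((Phi *m x)^T *m (Phi *m x)) 0 0.
  by rewrite -scalemxAr -scalemxAl mxE orth_proj_quad.
have cG : {within [set t : R | 0 <= t], continuous G}.
  by apply: is_derive_ge0_continuous => s s0; exact: derive_is_derive_ge0 (dG s s0).
have ndG := ge0_nondecreasing cG (fun t t0 => dG t (ltW t0)) (fun t _ => sqr_ge0 _).
split=> [Qx|Phix].
- have zt : z x x t = 0 by rewrite /z -mulmxA Qx mulmx0 mxE mulr0.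
  have dz_ge0 (s : R) : 0 < s -> 0 <= expR (beta * s) * (p s * p s).
    by rewrite mulr_ge0 ?expR_ge0// -expr2 sqr_ge0.
  have ndz := ge0_nondecreasing (@cz x x) (dz x x) dz_ge0.
  have p0 s : 0 < s < t -> p s = 0.
    move=> s0t; have /andP[s0 _] := s0t.
    have zt0 : z x x t <= z x x 0 by rewrite zt z0.
    have /eqP := nondecreasing_flat_derive0 ndz zt0 s0t (dz x x s0).
    by rewrite mulf_eq0 gt_eqF ?expR_gt0//= -expr2 sqrf_eq0 => /eqP.
  have cG' : {within `[0, T], continuous G}.
    by apply: continuous_subspaceW cG => s /=; rewrite in_itv/= => /andP[].
  have dG' s : s \in `]0, T[ -> is_derive s 1 G (p s ^+ 2).
    by rewrite in_itv/= => /andP[s0 _]; apply: dG; exact: ltW.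
  (* The Gram integral over [0, T] is T times p c ^+ 2 for some c < T <= t, hence 0; the lower
     excitation bound then forces Phi x = 0. *)
  have [c + GT] := MVT T0 dG' cG'; rewrite in_itv/= => /andP[c0 cT].
  have [+ _] := ppe 0 (lexx 0); rewrite add0r => /loewner_leP/(_ x).
  rewrite quadZ GE ?lexx// GT p0 ?c0 ?(lt_le_trans cT)// expr0n mul0r.
  by rewrite pmulr_rle0// => /dot_eq0.
- have p0 s : 0 < s -> p s = 0.
    (* A window [a, a + T] inside the half line with [s] strictly in its interior, even for small
       [s]. *)
    move=> s0; pose a := Num.max (s - T / 2) 0.
    have a0 : 0 <= a by rewrite le_max lexx orbT.
    have as_ : a < s < a + T.
      rewrite gt_max s0 -ltrBlDr lt_max andbT; apply/andP; split; last by apply/orP; left; lra.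
      by lra.
    have Ga : G (a + T) <= G a.
      have [_ /loewner_leP/(_ x)] := ppe a a0.
      by rewrite quadZ Phix mulmx0 GE ?a0 ?ltrDl// mxE mulr0 subr_le0.
    have ndGa u v : a <= u <= v -> G u <= G v.
      by move=> /andP[au uv]; apply: ndG; rewrite (le_trans a0).
    have /eqP := nondecreasing_flat_derive0 ndGa Ga as_ (dG s (ltW s0)).
    by rewrite sqrf_eq0 => /eqP.
  have t0 : 0 <= t by exact: le_trans (ltW T0) Tt.
  apply: dot_eq0; rewrite mulmxA.
  (* The vector [u] is frozen at time [t] while [z u x] evolves. Its derivative has the factor p s =
     0, so it stays at its initial value 0, and at time [t] this reads |Q t x|^2 = 0. *)
  pose u := Q t *m x.
  have -> : ((Q t *m x)^T *m Q t *m x) 0 0 = (u^T *m Q t *m x) 0 0 by [].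
  have := derive0_cst_grid ltr01 (@cz u x) _ t0.
  rewrite z0 => zt; have : z u x t = 0.
    apply: zt => s s0 _; apply: (is_derive_eq (dz u x s0)).
    by rewrite [X in _ * (_ * X)]p0// !mulr0.
  by move/eqP; rewrite mulf_eq0 gt_eqF ?expR_gt0//= => /eqP ->.
Qed.

End kernelQ.

(** * The equation of P *)

Section ge0_more.
Variable R : realType.

Lemma is_derive_ge0_eq (f g : R -> R) (t l : R) : 0 <= t ->
  (forall s, 0 <= s -> f s = g s) -> is_derive_ge0 g t l -> is_derive_ge0 f t l.
Proof.
move=> t0 fg; apply: cvg_trans; apply: near_eq_cvg; rewrite near_withinE.
by near=> s => s0; rewrite !fg.
Unshelve. all: by end_near. Qed.

Lemma within_mx (m n : nat) (A : set R) (f : R -> 'M[R]_(m, n)) :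
  (forall i j, {within A, continuous (fun t => f t i j)}) ->
  {within A, continuous f}.
Proof. by move=> cf x; apply: cvg_mx_coord => i j; exact: cf. Qed.

End ge0_more.

(** The convolution in the equation of [P] with its factor e^(- gamma t) taken out, so that [t]
    enters only through the upper limit. *)
Definition zoh_memory (R : realType) (n : nat) (gamma delta : R)
    (M : nat -> 'M[R]_n) (t : R) : 'M[R]_n :=
  \matrix_(i, j) \int[@lebesgue_measure R]_(x in `[0, t])
    (expR (gamma * x) * M (Num.truncn (x / delta)) i j).

(* The substitution [e^(gamma t) P t] turns the equation for [P] into
   [(e^(gamma t) P)' = weighted_rhs t], whose right-hand side is continuous. *)
Definition weighted_rhs (R : realType) (n : nat) (gamma delta : R)
    (M : nat -> 'M[R]_n) (t : R) : 'M[R]_n :=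
  gamma *: (expR (gamma * t) *: 1%:M - gamma *: zoh_memory gamma delta M t).

Section weighted_ode.
Variables (R : realType) (n : nat) (gamma delta : R) (M : nat -> 'M[R]_n).
Variable (P : R -> 'M[R]_n).
Notation J := (zoh_memory gamma delta M).
Notation h := (weighted_rhs gamma delta M).
Notation e t := (expR (gamma * t)).
Hypothesis gamma0 : 0 < gamma.
Hypothesis delta0 : 0 < delta.
Hypothesis pM : forall k, orth_proj (M k).

Hypothesis P0 : P 0 = 0.
Hypothesis cP : {within [set t : R | 0 <= t], continuous P}.
Hypothesis dP : forall t : R, 0 < t -> (forall k : nat, t != k%:R * delta) ->
  forall i j, is_derive t 1 (fun s => P s i j)
    (- gamma * P t i j + gamma * (i == j)%:R
     - gamma ^+ 2 * (expR (- gamma * t) * J t i j)).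

Lemma weighted_rhsE t i j : h t i j = gamma * (e t * (i == j)%:R - gamma * J t i j).
Proof. by rewrite !mxE. Qed.

Lemma continuous_zoh_memory i j : continuous (fun t : R => J t i j).
Proof.
rewrite /zoh_memory; under eq_fun do rewrite mxE.
apply: continuous_Rintegral0 => b.
exact: (zoh_integrable (fun k => M k i j) b delta0 (@continuous_expRM _ gamma)).
Qed.

Lemma continuous_weighted_rhs i j : continuous (fun t : R => h t i j).
Proof.
under eq_fun do rewrite weighted_rhsE.
move=> t; apply: cvgM; first exact: cvg_cst.
apply: cvgB; apply: cvgM; try exact: cvg_cst; first exact: continuous_expRM.
exact: continuous_zoh_memory.
Qed.

Lemma zoh_memory_piece (A : 'M[R]_n) (a b : R) : 0 <= a <= b ->
  (forall t, a <= t < b -> M (Num.truncn (t / delta)) = A) ->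
  J b = J a + ((e b - e a) / gamma) *: A.
Proof.
move=> ab MA; apply/matrixP => i j; rewrite !mxE [X in _ = _ + X]mulrC.
apply: (zoh_integral_piece (m := fun k => M k i j)) => //.
  by rewrite gt_eqF.
by move=> t /MA ->.
Qed.

Lemma zoh_memory0 : J 0 = 0.
Proof. by apply/matrixP => i j; rewrite !mxE set_itv1 Rintegral_set1. Qed.

Lemma zoh_memory_sym t i j : J t i j = J t j i.
Proof.
rewrite !mxE; apply: eq_Rintegral => x _.
by have [_ MT] := pM (Num.truncn (x / delta)); rewrite -[in LHS]MT mxE.
Qed.

Lemma expRM_le s t : s <= t -> e s <= e t.
Proof. by move=> st; rewrite ler_expR ler_pM2l. Qed.

(** This is 0 <= M k <= 1 integrated against e^(gamma x). Within one sampling interval [J] grows by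
    a nonnegative multiple of a single projection, and the upper bounds telescope over the grid. *)
Lemma zoh_memory_bounds x t : 0 <= t ->
  0 <= quad x (J t) <= (e t - 1) / gamma * quad x 1%:M.
Proof.
have step k u : k%:R * delta <= u <= k.+1%:R * delta ->
    0 <= quad x (J (k%:R * delta)) <= (e (k%:R * delta) - 1) / gamma * quad x 1%:M ->
    0 <= quad x (J u) <= (e u - 1) / gamma * quad x 1%:M.
  move=> /andP[ku uk] /andP[J_ge J_le].
  have kd : 0 <= k%:R * delta by rewrite mulr_ge0// ltW.
  rewrite (@zoh_memory_piece (M k) (k%:R * delta) u) ?kd//; last first.
    move=> s /andP[ks su]; congr M; apply: truncn_def.
    by rewrite ler_pdivlMr// ks ltr_pdivrMr// (lt_le_trans su).
  rewrite quadD quadZ.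
  have c0 : 0 <= (e u - e (k%:R * delta)) / gamma.
    by rewrite divr_ge0 ?(ltW gamma0)// subr_ge0 expRM_le.
  have [_ M_ge0] := orth_proj_psd (pM k).
  have [_ /(_ x) M_le1] := orth_proj_psd (orth_projC (pM k)).
  rewrite -/(quad _ _) quadB subr_ge0 in M_le1.
  apply/andP; split; first by rewrite addr_ge0// mulr_ge0// M_ge0.
  apply: le_trans (lerD J_le (ler_wpM2l c0 M_le1)) _.
  by rewrite -mulrDl ler_wpM2r ?quad1_ge0// -mulrDl addrC addrA subrK.
have grid : forall k : nat, 0 <= quad x (J (k%:R * delta)) <=
    (e (k%:R * delta) - 1) / gamma * quad x 1%:M.
  elim=> [|k IH].
    by rewrite mul0r zoh_memory0 /quad mulmx0 mul0mx mxE lexx mulr0 expR0 subrr !mul0r lexx.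
  by apply: step IH; rewrite lexx andbT ler_pM2r// ler_nat.
move=> t0; apply: step (grid (Num.truncn (t / delta))).
have /andP[] := truncn_itv (divr_ge0 t0 (ltW delta0)).
by rewrite ler_pdivlMr// ltr_pdivrMr// => -> /ltW.
Qed.

(** The right-hand side is continuous, so [G] exists by integration. The difference e^(gamma t) P -
    G is continuous with zero derivative off the sampling instants, hence constantly 0. *)
Lemma weighted_ode_primitive : exists G : R -> 'M[R]_n,
  [/\ G 0 = 0,
      forall t : R, 0 <= t -> forall i j, is_derive t 1 (fun s => G s i j) (h t i j) &
      forall t, 0 <= t -> P t = expR (- gamma * t) *: G t].
Proof.
have /choice[g gP] (ij : 'I_n * 'I_n) : exists g : R -> R,
    g 0 = 0 /\ forall t : R, 0 <= t -> is_derive t 1 g (h t ij.1 ij.2).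
  by apply: continuous_primitive; exact: continuous_weighted_rhs.
pose G t := \matrix_(i, j) g (i, j) t.
have GE i j : (fun t => G t i j) = g (i, j) by apply/funext => t; rewrite mxE.
exists G; split.
- by apply/matrixP => i j; rewrite !mxE; case: (gP (i, j)).
- by move=> t t0 i j; rewrite GE; exact: (gP (i, j)).2.
- move=> t t0; apply/matrixP => i j; rewrite !mxE.
  suff /eqP : e t * P t i j - g (i, j) t = 0.
    by rewrite subr_eq0 => /eqP <-; rewrite mulrA -expRD mulNr addNr expR0 mul1r.
  pose f s := e s * P s i j - g (i, j) s.
  have [g0 dg] := gP (i, j).
  rewrite -/(f t).
  have -> : 0 = f 0 by rewrite /f P0 mxE mulr0 g0 subr0.
  apply: (derive0_cst_grid delta0) t0.
    move=> s; apply: cvgB.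
      apply: cvgM; last exact: within_coord cP s.
      by apply: continuous_subspaceT; exact: continuous_expRM.
    apply: is_derive_ge0_continuous s => s s0.
    exact: derive_is_derive_ge0 (dg s s0).
  move=> s s0 sk.
  have dgs := dg s (ltW s0).
  have dPs := dP s0 sk i j.
  have des := is_derive_expRM gamma s.
  apply: (is_derive_eq (is_deriveB (is_deriveM des dPs) dgs)).
  rewrite /= weighted_rhsE /GRing.scale/=.
  have : expR (gamma * s) * expR (- gamma * s) = 1 by rewrite -expRD mulNr subrr expR0.
  move: (expR (gamma * s)) (expR (- gamma * s)) => a b ab.
  by ring: ab.
Qed.

(** The product rule for e^(- gamma t) G involves only the continuous functions [h] and [G], so
    nothing jumps at the sampling instants. *)
Lemma weighted_ode_C1 : C1_ge0 P.
Proof.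
have [G [G0 dG PG]] := weighted_ode_primitive.
pose d t := expR (- gamma * t) *: (h t - gamma *: G t).
exists d; split.
  move=> t t0; apply: is_derive_ge0_mx => i j.
  apply: (@is_derive_ge0_eq _ _ (fun s => expR (- gamma * s) * G s i j)) => //.
    by move=> s s0; rewrite PG// mxE.
  apply: derive_is_derive_ge0.
  apply: (is_derive_eq (is_deriveM (is_derive_expRM (- gamma) t) (dG t t0 i j))).
  rewrite /GRing.scale/= [RHS]mxE [X in _ = _ * X]mxE [X in _ = _ * (_ + X)]mxE.
  by rewrite [X in _ = _ * (_ - X)]mxE; ring.
apply: within_mx => i j.
rewrite (_ : (fun t => _) = (fun t => expR (- gamma * t) * (h t i j - gamma * G t i j))); last first.
  by apply/funext => t; rewrite !mxE.
move=> t; apply: cvgM; first by apply: continuous_subspaceT; exact: continuous_expRM.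
apply: cvgB; first by apply: continuous_subspaceT; exact: continuous_weighted_rhs.
apply: cvgM; first exact: cvg_cst.
apply: (@is_derive_ge0_continuous _ _ (fun s => h s i j)) t => t t0.
exact: derive_is_derive_ge0 (dG t t0 i j).
Qed.


(** Below: x^T G x starts at 0 and is nondecreasing, since gamma J <= e^(gamma t) - 1. Above:
    e^(gamma t) |x|^2 - x^T G x starts at |x|^2 and has derivative gamma^2 x^T J x >= 0. Symmetry of
    [P] is inherited from that of [J]. *)
Lemma weighted_ode_bounds t : 0 <= t -> loewner_le 0 (P t) /\ loewner_le (P t) 1%:M.
Proof.
have [G [G0 dG PG]] := weighted_ode_primitive.
have cG i j : {within [set t : R | 0 <= t], continuous (fun s => G s i j)}.
  apply: (@is_derive_ge0_continuous _ _ (fun s => h s i j)) => s s0.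
  exact: derive_is_derive_ge0 (dG s s0 i j).
move=> t0.
have PT : (P t)^T = P t.
  rewrite PG// linearZ/=; congr (_ *: _); apply/matrixP => i j; rewrite mxE.
  apply/eqP; rewrite -subr_eq0.
  have -> : 0 = G 0 j i - G 0 i j by rewrite G0 !mxE subrr.
  apply/eqP; apply: (@derive0_cst_grid _ 1 (fun s => G s j i - G s i j)) t0 => //.
    by move=> s; apply: cvgB; exact: cG.
  move=> s s0 _.
  apply: (is_derive_eq (is_deriveB (dG s (ltW s0) j i) (dG s (ltW s0) i j))).
  by rewrite !weighted_rhsE zoh_memory_sym eq_sym subrr.
have et x : quad x (P t) = expR (- gamma * t) * quad x (G t) by rewrite PG// quadZ.
have dGx x (s : R) : 0 < s -> is_derive s 1 (fun s => quad x (G s)) (quad x (h s)).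
  by move=> s0; apply: is_derive_bilin => i j; exact: dG s (ltW s0) i j.
have cGx x : {within [set t : R | 0 <= t], continuous (fun s => quad x (G s))}.
  exact: within_bilin.
have G0x x : quad x (G 0) = 0 by rewrite G0 /quad mulmx0 mul0mx mxE.
have hx x s : quad x (h s) = gamma * (e s * quad x 1%:M - gamma * quad x (J s)).
  by rewrite quadZ quadB !quadZ.
split; split; rewrite ?subr0 ?linearB/= ?trmx1 ?PT// => x.
- rewrite -/(quad x (P t)) et mulr_ge0 ?expR_ge0// -(G0x x).
  apply: (ge0_nondecreasing (cGx x) (dGx x)); last by rewrite lexx.
  move=> s s0; rewrite hx mulr_ge0 ?(ltW gamma0)// subr_ge0.
  have /andP[_ Js] := zoh_memory_bounds x (ltW s0).
  have := ler_wpM2l (ltW gamma0) Js.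
  have -> : gamma * ((e s - 1) / gamma * quad x 1%:M) = (e s - 1) * quad x 1%:M.
    by field; rewrite gt_eqF.
  move/le_trans; apply.
  by rewrite ler_wpM2r ?quad1_ge0// gerBl.
- rewrite -/(quad x (1%:M - P t)) quadB et subr_ge0.
  rewrite mulNr expRN ler_pdivrMl ?expR_gt0// .
  pose f s := e s * quad x 1%:M - quad x (G s).
  suff : 0 <= f t by rewrite subr_ge0.
  apply: (@le_trans _ _ (f 0)).
    by rewrite /f G0x mulr0 expR0 mul1r subr0 quad1_ge0.
  apply: (@ge0_nondecreasing _ f (fun s => gamma ^+ 2 * quad x (J s))); last by rewrite lexx.
  + move=> s; apply: cvgB; last exact: cGx.
    apply: cvgM; last exact: cvg_cst.
    by apply: continuous_subspaceT; exact: continuous_expRM.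
  + move=> s s0; have des := is_derive_expRM gamma s; have dGs := dGx x s s0.
    apply: (is_derive_eq (is_deriveB (is_deriveM des (is_derive_cst (quad x 1%:M) s 1)) dGs)).
    by rewrite hx /GRing.scale/=; ring.
  + move=> s s0; rewrite mulr_ge0 ?sqr_ge0//.
    by have /andP[] := zoh_memory_bounds x (ltW s0).
Qed.

Lemma weighted_ode_entry_decay (Phi : 'M[R]_n) (K : nat) i j :
  (forall k, (K <= k)%N -> M k = 1%:M - Phi) ->
  exists B C : R, forall t, 0 <= t ->
    `|P t i j - Phi i j| <= expR (- gamma * t) * (B + C * t).
Proof.
move=> MK; have [G [_ dG PG]] := weighted_ode_primitive.
pose t1 := K%:R * delta.
have t1_ge0 : 0 <= t1 by rewrite mulr_ge0// ltW.
have Jt t : t1 <= t -> J t = J t1 + ((e t - e t1) / gamma) *: (1%:M - Phi).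
  move=> t1t; apply: zoh_memory_piece; first by rewrite t1_ge0.
  move=> s /andP[t1s _]; apply: MK.
  have sd : 0 <= s / delta by rewrite divr_ge0 ?(ltW delta0)// (le_trans t1_ge0).
  by rewrite truncn_ge_nat// ler_pdivlMr.
(* Beyond [t1] the entry of [h] is gamma e^(gamma t) Phi i j + C. Hence [G] is there Phi e^(gamma t)
   + C t up to a constant, and [D] is that constant. *)
pose C := gamma * e t1 * (1%:M - Phi) i j - gamma ^+ 2 * J t1 i j.
pose D t := G t i j - Phi i j * e t - C * t.
have cD : {within [set t : R | 0 <= t], continuous D}.
  move=> t; apply: cvgB; last by apply: continuous_subspaceT; exact: mulrl_continuous.
  apply: cvgB.
    apply: (@is_derive_ge0_continuous _ _ (fun s => h s i j)) t => s s0.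
    exact: derive_is_derive_ge0 (dG s s0 i j).
  apply: cvgM; first exact: cvg_cst.
  by apply: continuous_subspaceT; exact: continuous_expRM.
have Dcst t : t1 <= t -> D t = D t1.
  move=> t1t; apply/eqP; rewrite -subr_eq0; apply/eqP.
  have dD (s : R) : s \in `]t1, t[ -> is_derive s 1 D 0.
    rewrite in_itv/= => /andP[t1s st].
    have dGs := dG s (le_trans t1_ge0 (ltW t1s)) i j.
    have des := is_deriveZ (Phi i j) (is_derive_expRM gamma s).
    have dCs := is_deriveZ C (is_derive_id s 1).
    apply: (is_derive_eq (is_deriveB (is_deriveB dGs des) dCs)).
    rewrite weighted_rhsE Jt ?(ltW t1s)// /GRing.scale/= /C; move: (J t1) => J1.
    rewrite !mxE; move: (expR _) (expR _) (_ %:R) (J1 i j) (Phi i j) => a b c d f.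
    by field; rewrite gt_eqF.
  have cD' : {within `[t1, t], continuous D}.
    apply: continuous_subspaceW cD => s /=; rewrite in_itv/= => /andP[+ _].
    exact: le_trans.
  by have [c _ ->] := MVT_segment t1t dD cD'; rewrite mul0r.
(* The transient before [t1] is bounded by compactness; afterwards [D] keeps the value D t1. *)
have [B DB] : exists B, forall t, 0 <= t -> `|D t| <= B.
  have cD' : {within `[0, t1], continuous D}.
    by apply: continuous_subspaceW cD => s /=; rewrite in_itv/= => /andP[].
  have [B [_ DB]] := compact_bounded (continuous_compact cD' (@segment_compact _ 0 t1)).
  exists (`|B| + 1) => t t0.
  have B1 : B < `|B| + 1 by rewrite (le_lt_trans (ler_norm B))// ltrDl.
  have [tt1|t1t] := leP t t1; apply: (DB _ B1).
    by exists t => //=; rewrite in_itv/= t0.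
  by exists t1; [rewrite /= in_itv/= t1_ge0 lexx|rewrite Dcst// ltW].
exists B, `|C| => t t0.
have -> : P t i j - Phi i j = expR (- gamma * t) * (D t + C * t).
  rewrite PG// mxE /D subrK mulrBr; congr (_ - _).
  by rewrite mulrCA -expRD mulNr addNr expR0 mulr1.
rewrite normrM ger0_norm ?expR_ge0// ler_wpM2l ?expR_ge0//.
by rewrite (le_trans (ler_normD _ _))// normrM (ger0_norm t0) lerD// DB.
Qed.

End weighted_ode.

(** * Convergence of the algorithm and its rate *)

Lemma smooth_ge0_coord_continuous (R : realType) (n : nat) (phi : R -> 'cV[R]_n) i :
  smooth_ge0 phi ->
  {within [set t : R | 0 <= t], continuous (fun t => phi t i 0)}.
Proof.
move=> [d [d0 dd]].
apply: (@subspace_eq_continuous _ _ _ (fun t => d 0%N t i 0)).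
  by move=> t; rewrite inE/= => t0; rewrite d0.
apply: (@is_derive_ge0_continuous _ _ (fun s => d 1%N s i 0)) => s s0.
exact: is_derive_ge0_coord (dd 0%N s s0).
Qed.

(** The number of columns of [Nhat k] varies with [k]; passing to projections gives a sequence in
    one fixed matrix type. *)
Definition colproj (R : realType) (n k : nat) (N : 'M[R]_(n, k)) : 'M[R]_n :=
  N *m N^T.

Lemma P_rhsE (R : realType) (n : nat) (gamma delta : R) (d : nat -> nat)
    (Nhat : forall k, 'M[R]_(n, d k)) (P : R -> 'M[R]_n) (t : R) i j :
  0 < delta ->
  P_rhs gamma delta Nhat P t i j =
  - gamma * P t i j + gamma * (i == j)%:R - gamma ^+ 2 * (expR (- gamma * t) *
    \int[@lebesgue_measure R]_(x in `[0, t]) (expR (gamma * x) *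
      (Nhat (Num.truncn (x / delta)) *m (Nhat (Num.truncn (x / delta)))^T) i j)).
Proof.
move=> d0; rewrite /P_rhs !mxE mulr_natr; congr (_ - _ * _).
rewrite -RintegralZl//; last first.
  exact: (zoh_integrable (fun k => (Nhat k *m (Nhat k)^T) i j) t d0 (@continuous_expRM _ gamma)).
apply: eq_Rintegral => x _; rewrite [LHS]mxE mulrA -expRD; congr (expR _ * _).
by ring.
Qed.

(** Half of the exponent absorbs the affine factor, through 1 + (gamma / 2) t <= e^((gamma / 2) t),
    which is also the origin of 2 / gamma; the other half gives the rate. *)
Lemma expR_affine_decay (R : realType) (gamma r B C t : R) :
  0 < gamma -> r <= gamma / 2 -> 0 <= B -> 0 <= C -> 0 <= t ->
  expR (- gamma * t) * (B + C * t) <= (B + C * (2 / gamma)) * expR (- r * t).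
Proof.
move=> g0 rg B0 C0 t0.
have er : expR (- gamma * t) * expR (gamma / 2 * t) <= expR (- r * t).
  by rewrite -expRD ler_expR -mulrDl ler_wpM2r//; lra.
have et : 1 + gamma / 2 * t <= expR (gamma / 2 * t) by exact: expR_ge1Dx.
have gt : 0 <= gamma / 2 * t by rewrite mulr_ge0// ltW// divr_gt0.
have k0 : 0 <= B + C * (2 / gamma).
  by rewrite addr_ge0// mulr_ge0// divr_ge0// ltW.
apply: le_trans (ler_wpM2l k0 er).
rewrite [leRHS]mulrCA; apply: ler_wpM2l; rewrite ?expR_ge0// mulrDl lerD//.
  by rewrite ler_peMr//; lra.
rewrite -[leRHS]mulrA; apply: ler_wpM2l => //; rewrite -ler_pdivrMl ?divr_gt0//.
by rewrite invf_div; lra.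
Qed.

Section pe_algorithm_convergence.
Variables (R : realType) (n q : nat) (phi : R -> 'cV[R]_n)
    (Phi : 'M[R]_n) (Nd : 'M[R]_(n, n - q)) (Nu : 'M[R]_(n, q)) (beta gamma delta : R).
Hypotheses (hsmooth : smooth_ge0 phi) (hppe : ppe_with phi q Phi)
    (hN : pe_splitting Phi Nd Nu) (hdelta : 0 < delta) (hgamma : 0 < gamma).
Variables (Q : R -> 'M[R]_n) (d : nat -> nat)
      (Nhat : forall k : nat, 'M[R]_(n, d k)) (P : R -> 'M[R]_n).
Hypothesis hPE : pe_algorithm beta gamma delta phi Q Nhat P.

Notation M := (fun k => colproj (Nhat k)).

Lemma colproj_Nhat_orth_proj k : orth_proj (colproj (Nhat k)).
Proof. by apply: orth_proj_onb; case: (pe_Nhat hPE k). Qed.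

Lemma colproj_Nhat_eventually :
  exists K, forall k, (K <= k)%N -> colproj (Nhat k) = 1%:M - Phi.
Proof.
have [pPhi _ [T [ka [kb [T0 ka0 _ ppe]]]]] := hppe.
(* [truncn] rounds down, so the successor guarantees T < k delta. *)
exists (Num.truncn (T / delta)).+1 => k Kk.
apply: (onb_Ker_proj pPhi _ (pe_Nhat hPE k)).
apply: (ker_ppe (pe_Q0 hPE) (pe_Q_ode hPE) _ pPhi T0 ka0 ppe).
  by move=> i; exact: smooth_ge0_coord_continuous.
rewrite -ler_pdivrMr// ltW// (lt_le_trans (truncnS_gt _))//.
by rewrite ler_nat.
Qed.

Lemma is_derive_P_coord (t : R) : 0 < t -> (forall k : nat, t != k%:R * delta) ->
  forall i j, is_derive t 1 (fun s => P s i j)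
    (- gamma * P t i j + gamma * (i == j)%:R
     - gamma ^+ 2 * (expR (- gamma * t) * zoh_memory gamma delta M t i j)).
Proof.
move=> t0 tk i j; rewrite mxE -P_rhsE//.
apply: is_derive_ge0_derive => //.
exact: is_derive_ge0_coord (pe_P_ode hPE (ltW t0) tk).
Qed.

Lemma pe_algorithm_converges :
  [/\ C1_ge0 P, forall t, 0 <= t -> loewner_le 0 (P t) /\ loewner_le (P t) 1%:M &
      forall r, r <= gamma / 2 -> exists2 rho_a : R, 0 < rho_a &
      forall t, 0 <= t ->
        opnorm (P t - Nd *m Nd^T) <= rho_a * expR (- r * t)].
Proof.
have cP := pe_P_cont hPE; have P0 := pe_P0 hPE.
split.
- exact: weighted_ode_C1 hdelta P0 cP is_derive_P_coord.
- move=> t t0.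
  exact: (weighted_ode_bounds hgamma hdelta colproj_Nhat_orth_proj P0 cP
    is_derive_P_coord t0).
move=> r rg.
have [pPhi _ _] := hppe; have [NdPhi _ _ _] := hN.
rewrite (onb_Im_proj pPhi NdPhi).
have [K MK] := colproj_Nhat_eventually.
have /choice[B HB] (ij : 'I_n * 'I_n) : exists BC : R * R, forall t, 0 <= t ->
    `|P t ij.1 ij.2 - Phi ij.1 ij.2| <= expR (- gamma * t) * (BC.1 + BC.2 * t).
  have [B [C BC]] := weighted_ode_entry_decay hgamma hdelta P0 cP
    is_derive_P_coord ij.1 ij.2 MK.
  by exists (B, C).
pose b i j := `|(B (i, j)).1| + `|(B (i, j)).2| * (2 / gamma).
(* The added 1 keeps the constant positive when the sum is 0, for instance if n = 0. *)
exists (\sum_i \sum_j b i j + 1).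
  rewrite ltr_wpDl// sumr_ge0// => i _; rewrite sumr_ge0// => j _.
  by rewrite addr_ge0// mulr_ge0// divr_ge0// ltW.
move=> t t0; apply: le_trans (opnorm_le_sum _) _.
rewrite mulrDl mul1r -[leLHS]addr0 lerD ?expR_ge0// mulr_suml.
apply: ler_sum => i _; rewrite mulr_suml; apply: ler_sum => j _.
rewrite !mxE; apply: le_trans (HB (i, j) t t0) _ => /=.
apply: le_trans (expR_affine_decay hgamma rg _ _ t0) => //.
rewrite ler_wpM2l ?expR_ge0// lerD ?ler_norm// ler_wpM2r// ler_norm//.
Qed.

End pe_algorithm_convergence.

Theorem theorem1 (R : realType) (n q : nat) (phi : R -> 'cV[R]_n)
    (Phi : 'M[R]_n) (Nd : 'M[R]_(n, n - q)) (Nu : 'M[R]_(n, q))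
    (beta delta : R)
    (hq : (q <= n)%N)
    (hsmooth : smooth_ge0 phi)
    (hbounded : bounded_ge0 phi)
    (hppe : ppe_with phi q Phi)
    (hN : pe_splitting Phi Nd Nu)
    (hbeta : 0 < beta) (hdelta : 0 < delta) :
  (forall (gamma : R) (Q : R -> 'M[R]_n) (d : nat -> nat)
      (Nhat : forall k : nat, 'M[R]_(n, d k)) (P : R -> 'M[R]_n),
    0 < gamma ->
    pe_algorithm beta gamma delta phi Q Nhat P ->
    [/\ C1_ge0 P,
        forall t, 0 <= t -> loewner_le 0 (P t) /\ loewner_le (P t) 1%:M &
        exists rho_a rho_b : R, [/\ 0 < rho_a, 0 < rho_b &
          forall t, 0 <= t ->
            opnorm (P t - Nd *m Nd^T) <= rho_a * expR (- rho_b * t)]]) /\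
  (forall r : R, 0 < r ->
    exists2 gamma0 : R, 0 < gamma0 &
    forall gamma : R, gamma0 <= gamma ->
    forall (Q : R -> 'M[R]_n) (d : nat -> nat)
      (Nhat : forall k : nat, 'M[R]_(n, d k)) (P : R -> 'M[R]_n),
    pe_algorithm beta gamma delta phi Q Nhat P ->
    exists2 rho_a : R, 0 < rho_a &
      forall t, 0 <= t ->
        opnorm (P t - Nd *m Nd^T) <= rho_a * expR (- r * t)).
Proof.
split.
  move=> gamma Q d Nhat P g0 hPE.
  have [C1P boundsP decay] := pe_algorithm_converges hsmooth hppe hN hdelta g0 hPE.
  split=> //; have [rho_a rho_a0 rhoP] := decay _ (lexx (gamma / 2)).
  by exists rho_a, (gamma / 2); split=> //; rewrite divr_gt0.
(* Every rate up to gamma / 2 is available, so 2 r <= gamma is what [r] requires. *)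
move=> r r0; exists (2 * r); first by rewrite mulr_gt0.
move=> gamma rg Q d Nhat P hPE.
have g0 : 0 < gamma by rewrite (lt_le_trans _ rg)// mulr_gt0.
have [_ _ decay] := pe_algorithm_converges hsmooth hppe hN hdelta g0 hPE.
by apply: decay; rewrite ler_pdivlMr// mulrC.
Qed.
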